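(* Let $\beta^0\in\mathbb{R}^p$, let $\boldsymbol\lambda^n$ and $\boldsymbol\lambda$ be vectors in $\mathbb{R}^p$ with non-increasing non-negative entries such that $\boldsymbol\lambda^n/\sqrt n\to\boldsymbol\lambda$ as $n\to\infty$. Given $u\in\mathbb{R}^p$, let $\mathfrak p=\mathbf{patt}(u)$ and $\mathfrak p_0=\mathbf{patt}_{\beta^0}(\mathfrak p)$. Then: i) there exists $\epsilon>0$ such that for all $v\in B_\epsilon(u)$: $J'_{\boldsymbol\lambda}(\beta^0;v)=J_{\boldsymbol\lambda}(\mathfrak p_0;v)$; ii) $\partial J'_{\boldsymbol\lambda}(\beta^0;\mathfrak p)=\partial J_{\boldsymbol\lambda}(\mathfrak p_0)$; iii) $\partial_uJ_{\boldsymbol\lambda^n}(\beta^0+u/\sqrt n)\to\partial J'_{\boldsymbol\lambda}(\beta^0;\mathfrak p)$ in the Hausdorff distance $d_H$ as $n\to\infty$.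
   Context: SLOPE norm: for $\boldsymbol{\lambda}$ with $\lambda_1\ge\dots\ge\lambda_p\ge0$, $J_{\boldsymbol{\lambda}}(\beta)=\sum_{i=1}^p\lambda_i|\beta|_{(i)}$, where $|\beta|_{(1)}\ge\dots\ge|\beta|_{(p)}$ are the sorted absolute values of the coordinates of $\beta$. $J'_{\boldsymbol\lambda}(\beta^0;v)$ is the directional derivative of $J_{\boldsymbol\lambda}$ at $\beta^0$ in direction $v$. $\partial$ denotes the convex subdifferential. SLOPE pattern: $\mathbf{patt}:\mathbb{R}^p\to\mathbb{Z}^p$, $\mathbf{patt}(u)_i=\mathrm{rank}(|u_i|)\,\mathrm{sgn}(u_i)$, where $\mathrm{rank}(|u_i|)$ is the rank of $|u_i|$ among the distinct values of $|u|$: value $0$ has rank $0$ and the $k$-th smallest distinct nonzero value of $|u_1|,\dots,|u_p|$ has rank $k$. $\mathfrak P=\mathbf{patt}(\mathbb{R}^p)$ is the finite set of patterns. Limiting pattern: $\mathbf{patt}_{\beta^0}(u)=\lim_{\epsilon\downarrow0}\mathbf{patt}(\beta^0+\epsilon u)$ (the right side is eventually constant); for $\mathfrak p\in\mathfrak P$, $\mathbf{patt}_{\beta^0}(\mathfrak p)=\mathbf{patt}_{\beta^0}(u)$ for any $u$ with $\mathbf{patt}(u)=\mathfrak p$ (this does not depend on the choice of $u$). Subdifferentials at patterns: $\partial J_{\boldsymbol\lambda}(\mathfrak p_0):=\partial J_{\boldsymbol\lambda}(w)$ for any $w\in\mathbb{R}^p$ with $\mathbf{patt}(w)=\mathfrak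 p_0$ (independent of the choice). $\partial J'_{\boldsymbol\lambda}(\beta^0;\mathfrak p)$ is the subdifferential of the convex function $v\mapsto J'_{\boldsymbol\lambda}(\beta^0;v)$ at $v=u$, where $\mathbf{patt}(u)=\mathfrak p$. $\partial_uJ_{\boldsymbol\lambda^n}(\beta^0+u/\sqrt n)$ is the subdifferential of $v\mapsto J_{\boldsymbol\lambda^n}(\beta^0+v/\sqrt n)$ at $v=u$. Local representation: for a pattern $\mathfrak q\in\mathfrak P$, let $S_{\mathfrak q}$ be the diagonal matrix with $(S_{\mathfrak q})_{ii}=1$ if $\mathfrak q_i=0$ and $(S_{\mathfrak q})_{ii}=\mathrm{sgn}(\mathfrak q_i)$ otherwise; let $\mathcal S(\mathfrak q)$ be the group of signed permutation matrices $\Sigma$ with $\Sigma|\mathfrak q|=|\mathfrak q|$ (with $|\mathfrak q|$ the coordinatewise absolute value); and let $\Pi_{\mathfrak q}$ be a fixed permutation matrix with $(\Pi_{\mathfrak q}^T|\mathfrak q|)_1\ge\dots\ge(\Pi_{\mathfrak q}^T|\mathfrak q|)_p$. Then for $v\in\mathbb{R}^p$ $$J_{\boldsymbol\lambda}(\mathfrak q;v):=\max\{\langle S_{\mathfrak q}\Sigma\Pi_{\mathfrak q}\boldsymbol\lambda,v\rangle:\Sigma\in\mathcal S(\mathfrak q)\}.$$ Hausdorff distance: for non-empty $A,B\subset\mathbb{R}^p$, $d_H(A,B)=\inf\{\delta\ge0: A\subset B^\delta,\ B\subset A^\delta\}$, where $B^\delta=\{x: d(x,B)\le\delta\}$. $B_\epsilon(u)$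 is the open ball of radius $\epsilon$ around $u$. *)

(* Defs.v *)
From HB Require Import structures.
From mathcomp Require Import all_boot all_order all_algebra.
From mathcomp Require Import all_fingroup.
From mathcomp Require Import all_classical all_reals all_analysis.

Set Implicit Arguments.
Unset Strict Implicit.
Unset Printing Implicit Defensive.
Import Order.TTheory GRing.Theory Num.Theory.
Import numFieldNormedType.Exports.

Local Open Scope classical_set_scope.
Local Open Scope ring_scope.

Section Euclidean.
Context {R : realType} {p : nat}.
Implicit Types (x y : 'cV[R]_p) (A B : set 'cV[R]_p).

Definition dot x y : R := \sum_(i < p) x i 0 * y i 0.

(* The library norm on matrices is the sup norm, hence this definition. *)
Definition enorm x : R := Num.sqrt (dot x x).

Definition eball x (r : R) : set 'cV[R]_p := [set y | enorm (y - x) < r].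

(* Infima are taken in the extended reals: the distance to the empty set and
   the Hausdorff distance between sets not within bounded distance of each
   other are +oo instead of a junk real value. *)
Definition dist_set x B : \bar R := ereal_inf [set (enorm (x - y))%:E | y in B].

Definition thickening B (delta : R) : set 'cV[R]_p :=
  [set x | (dist_set x B <= delta%:E)%E].

Definition hausdorff_dist A B : \bar R :=
  ereal_inf [set delta%:E | delta in
    [set delta : R | [/\ 0 <= delta, A `<=` thickening B delta
                       & B `<=` thickening A delta]]].

Definition subdiff (f : 'cV[R]_p -> R) x : set 'cV[R]_p :=
  [set g | forall y, f x + dot g (y - x) <= f y].

End Euclidean.

Section Slope.
Context {R : realType} {p : nat}.
Implicit Types (lam beta u v w : 'cV[R]_p).

Definition slope_weights lam : Prop :=
  (forall i j : 'I_p, (i <= j)%N -> lam j 0 <= lam i 0) /\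
  (forall i : 'I_p, 0 <= lam i 0).

Definition slope lam beta : R :=
  \sum_(i < p) lam i 0 * (sort >=%R [seq `|beta j 0| | j : 'I_p])`_i.

(* One-sided; the library's 'D_v is the two-sided derivative. *)
Definition slope_dir lam beta v : R :=
  lim ((slope lam (beta + t *: v) - slope lam beta) / t @[t --> 0^'+]).

(* Adding 0 to the list of values gives 0 the index 0 in the increasing list of
   distinct values, and the k-th smallest nonzero value the index k, whether or
   not 0 is one of the values. *)
Definition abs_rank u (i : 'I_p) : nat :=
  index `|u i 0| (sort <=%R (undup (0 :: [seq `|u j 0| | j : 'I_p]))).

Definition patt u : 'cV[int]_p :=
  \col_i ((abs_rank u i)%:Z * sgz (u i 0)).

Definition patterns : set 'cV[int]_p := range patt.

Definition patt_lim beta u : 'cV[int]_p :=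
  xget 0 [set q | \forall t \near 0^'+, patt (beta + t *: u) = q].

(* An object "defined through any representative of q" is encoded here as the
   one that every representative of q yields; the default value of [xget] would
   only be used if the representatives disagreed. *)
Definition patt_lim_pattern beta (q : 'cV[int]_p) : 'cV[int]_p :=
  xget 0 [set q0 | forall u, patt u = q -> patt_lim beta u = q0].

Definition subdiff_slope_pattern lam (q : 'cV[int]_p) : set 'cV[R]_p :=
  xget set0 [set D | forall w, patt w = q -> subdiff (slope lam) w = D].

Definition subdiff_slope_dir_pattern lam beta (q : 'cV[int]_p) :
    set 'cV[R]_p :=
  xget set0
    [set D | forall u, patt u = q -> subdiff (slope_dir lam beta) u = D].

Definition abs_pattern (q : 'cV[int]_p) : 'cV[R]_p :=
  \col_i (`|q i 0|)%:~R.

Definition sign_mx (q : 'cV[int]_p) : 'M[R]_p :=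
  diag_mx (\row_i (if q i 0 == 0 then 1 else (sgz (q i 0))%:~R)).

Definition signed_perm_mx (A : 'M[R]_p) : Prop :=
  exists (d : 'rV[R]_p) (s : 'S_p),
    (forall i, d 0 i = 1 \/ d 0 i = -1) /\ A = diag_mx d *m perm_mx s.

Definition pattern_stab (q : 'cV[int]_p) : set 'M[R]_p :=
  [set A | signed_perm_mx A /\ A *m abs_pattern q = abs_pattern q].

Definition sorting_perm_mx (q : 'cV[int]_p) (P : 'M[R]_p) : Prop :=
  is_perm_mx P /\
  forall i j : 'I_p, (i <= j)%N ->
    (P^T *m abs_pattern q) j 0 <= (P^T *m abs_pattern q) i 0.

(* [P] plays the role of Pi_q. The set is finite and nonempty, so its supremum
   is a maximum. *)
Definition slope_local (P : 'M[R]_p) lam (q : 'cV[int]_p) v : R :=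
  sup [set dot (sign_mx q *m A *m P *m lam) v | A in pattern_stab q].

End Slope.

Arguments patterns R p : clear implicits.

(* Main.v *)
Require Import Defs.
From HB Require Import structures.
From mathcomp Require Import all_boot all_order all_algebra.
From mathcomp Require Import all_fingroup.
From mathcomp Require Import all_classical all_reals all_analysis.
From mathcomp Require Import ring lra.

Set Implicit Arguments.
Unset Strict Implicit.
Unset Printing Implicit Defensive.
Import Order.TTheory GRing.Theory Num.Theory.
Import numFieldNormedType.Exports.

Local Open Scope classical_set_scope.
Local Open Scope ring_scope.

(** The SLOPE norm is a maximum of linear functionals: by the rearrangement
    inequality, [slope lam w] is the largest value at [w] of the vectors
    [signed_perm e s lam], where [(e, s)] runs over the signed permutations
    (sign flips [e], permutation [s]). The signed permutations that sort [w]
    ([aligned w e s]) attain the maximum, whatever the weights are.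

    Which signed permutations sort [w] depends only on the signs of the linear
    forms [+- w_i +- w_j], the roots of type B, and so does the pattern of [w]:
    two vectors have the same pattern exactly when all these signs agree
    ([patt_eqP]). The relation [refines v w] (every root nonnegative at [v] is
    nonnegative at [w]) says that [w] is a degeneration of [v]; whatever sorts
    [v] then sorts [w]. For small [t > 0] the signs of the roots at [b + t u]
    are lexicographic in [(b, u)] ([near0_broot]), which gives the limiting
    pattern and three degenerations: [b + t u] refines [b]; every [v] close to
    [u] refines [u]; and if [v] refines [u], then [b + t v] refines every [w]
    having the limiting pattern of [u] at [b] ([near0_refines]).

    Part (i). The directional derivative of the norm at [b] along [v] is the
    value at [v] of any [signed_perm e s lam] with [(e, s)] sorting [b + t v]
    for small [t], and it dominates the values of all those sorting [b]. For [v]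
    close to [u] the former sort [w], and everything that sorts [w] sorts [b];
    hence the derivative is the maximum over the signed permutations that sort
    [w]. These are the products [sign_mx q *m A *m P] with [A] in the stabilizer
    of [q = patt w] ([pattern_stab_aligned]).

    Part (ii). The same degenerations show that the two subdifferentials are one
    and the same set [active_hull lam w], the convex hull of the vectors
    [signed_perm e s lam] with [(e, s)] sorting [w].

    Part (iii). For large [n] the vector [b + u / sqrt n] has the limiting
    pattern, so the subdifferential is [active_hull mu w] with
    [mu = lamn n / sqrt n]. Signed permutations are isometries, hence the two
    hulls are within [enorm (mu - lam)] of each other: if [h] is the projection
    of [g] in the first hull onto the second, testing [g] in the direction
    [g - h] gives [enorm (g - h) <= enorm (mu - lam)] ([slope_thickening]). *)

(** * Euclidean geometry and projection onto a subdifferential *)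

Section Euclidean.
Context {R : realType} {p : nat}.
Implicit Types (x y z : 'cV[R]_p).

Lemma dotC x y : dot x y = dot y x.
Proof. by apply: eq_bigr => i _; rewrite mulrC. Qed.

Lemma dotDl x y z : dot (x + y) z = dot x z + dot y z.
Proof. by rewrite -big_split; apply: eq_bigr => i _; rewrite mxE mulrDl. Qed.

Lemma dotZl (a : R) x z : dot (a *: x) z = a * dot x z.
Proof. by rewrite mulr_sumr; apply: eq_bigr => i _; rewrite mxE mulrA. Qed.

Lemma dotNl x z : dot (- x) z = - dot x z.
Proof. by rewrite -scaleN1r dotZl mulN1r. Qed.

Lemma dotDr x y z : dot z (x + y) = dot z x + dot z y.
Proof. by rewrite !(dotC z) dotDl. Qed.

Lemma dotZr (a : R) x z : dot z (a *: x) = a * dot z x.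
Proof. by rewrite !(dotC z) dotZl. Qed.

Lemma dotNr x z : dot z (- x) = - dot z x.
Proof. by rewrite !(dotC z) dotNl. Qed.

Definition dotE := (dotDl, dotNl, dotZl, dotDr, dotNr, dotZr).

Lemma dot_ge0 x : 0 <= dot x x.
Proof. by apply: sumr_ge0 => i _; rewrite -expr2 sqr_ge0. Qed.

Lemma dot_delta x (i : 'I_p) : dot x (delta_mx i 0) = x i 0.
Proof.
rewrite /dot (bigD1 i)//= big1 ?addr0 => [|j /negbTE ji].
  by rewrite mxE !eqxx mulr1.
by rewrite mxE ji mulr0.
Qed.

Lemma enorm_ge0 x : 0 <= enorm x.
Proof. exact: sqrtr_ge0. Qed.

Lemma sqr_enorm x : enorm x ^+ 2 = dot x x.
Proof. by rewrite sqr_sqrtr ?dot_ge0. Qed.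

Lemma enormN x : enorm (- x) = enorm x.
Proof. by rewrite /enorm !dotE opprK. Qed.

Lemma coord_le_enorm x (i : 'I_p) : `|x i 0| <= enorm x.
Proof.
rewrite -sqrtr_sqr ler_sqrt ?dot_ge0// /dot (bigD1 i)//= -expr2 lerDl.
by apply: sumr_ge0 => j _; rewrite -expr2 sqr_ge0.
Qed.

Lemma dot_le_enorm x y : dot x y <= enorm x * enorm y.
Proof.
have [a0 b0] := (enorm_ge0 x, enorm_ge0 y).
have [ab0|ab0] := eqVneq (enorm x * enorm y) 0.
  suff -> : dot x y = 0 by rewrite mulr_ge0.
  apply: big1 => i _; apply/eqP; rewrite -normr_le0 normrM.
  apply: le_trans (_ : enorm x * enorm y <= 0); last by rewrite ab0.
  by rewrite ler_pM ?coord_le_enorm.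
have ab_gt0 : 0 < enorm x * enorm y by rewrite lt0r ab0 mulr_ge0.
have := dot_ge0 (enorm y *: x - enorm x *: y).
rewrite !dotE -!sqr_enorm (dotC y x) => h.
rewrite -subr_ge0 -(pmulr_rge0 _ ab_gt0) -(pmulr_rge0 _ (ltr0n R 2)).
by move: h; congr (0 <= _); ring.
Qed.

Lemma cvg_dot (T : Type) (F : set_system T) {FF : Filter F}
    (f g : T -> 'cV[R]_p) x y :
  (forall i, f t i 0 @[t --> F] --> x i 0) ->
  (forall i, g t i 0 @[t --> F] --> y i 0) ->
  dot (f t) (g t) @[t --> F] --> dot x y.
Proof.
move=> fx gy; apply: cvg_big => [|i _]; first exact: add_continuous.
exact: cvgM.
Qed.

(** A subgradient is bounded coordinatewise by the increments of [f] along the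
    coordinate axes, so a subdifferential is compact as well as convex, and
    every point has a nearest point in it; the obtuse-angle inequality is the
    first-order condition at that point. *)
Lemma subdiff_projection (f : 'cV[R]_p -> R) x g :
  subdiff f x !=set0 ->
  exists2 h, subdiff f x h & forall k, subdiff f x k -> dot (g - h) (k - h) <= 0.
Proof.
move=> [g0 fg0].
have trC i : continuous (fun w : 'rV[R]_p => w^T i 0).
  by under eq_fun do rewrite mxE; exact: coord_continuous.
pose A : set 'rV[R]_p := [set v | subdiff f x v^T].
have A0 : A !=set0 by exists g0^T; rewrite /A/= trmxK.
have Acl : closed A.
  have -> : A = \bigcap_(y in setT)
      ((fun v : 'rV[R]_p => dot v^T (y - x)) @^-1` [set r | r <= f y - f x]).
    apply/seteqP; split=> v /= fv y; first by move=> _ /=; rewrite lerBrDl.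
    by rewrite -lerBrDl; exact: (fv y I).
  apply: closed_bigI => y _; apply: preimage_closed; last exact: closed_le.
  move=> v _; apply: (@cvg_dot _ (nbhs v) (nbhs_filter v)) => i; last exact: cvg_cst.
  exact: (trC i v).
pose inc (i : 'I_p) := f (x + delta_mx i 0) - f x.
pose dec (i : 'I_p) := f (x - delta_mx i 0) - f x.
have AM v i : A v -> `|v 0 i| <= `|inc i| + `|dec i|.
  move=> Av; have := Av (x + delta_mx i 0); have := Av (x - delta_mx i 0).
  have xK e : x + e - x = e by rewrite addrAC subrr add0r.
  rewrite !xK !dotE dot_delta mxE -!lerBrDl -/(inc i) -/(dec i).
  have := ler_norm (inc i); have := ler_norm (dec i).
  have := normr_ge0 (inc i); have := normr_ge0 (dec i).
  move=> ? ? ? ? ? ?; rewrite ler_norml; lra.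
have Aco : compact A.
  pose B (i : 'I_p) := `[- (`|inc i| + `|dec i|), `|inc i| + `|dec i|]%classic.
  have Bco : compact [set v : 'rV[R]_p | forall i, B i (v ord0 i)].
    by apply: rV_compact => i; exact: segment_compact.
  apply: (subclosed_compact Acl Bco) => v Av i.
  by rewrite /B/= in_itv/= -ler_norml AM.
pose F (v : 'rV[R]_p) := dot (g - v^T) (g - v^T).
have Fc : continuous F.
  have c i : continuous (fun w : 'rV[R]_p => (g - w^T) i 0).
    have -> : (fun w : 'rV[R]_p => (g - w^T) i 0) = (fun w => g i 0 - w^T i 0).
      by apply/funext => w; rewrite !mxE.
    by move=> v; apply: continuousB; [exact: cst_continuous|exact: trC].
  by move=> v; apply: (@cvg_dot _ (nbhs v) (nbhs_filter v)) => i; exact: (c i v).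
have Fs : {within A, continuous F} by exact: continuous_subspaceT.
have [c cA cmin] := EVT_min_rV A0 Aco Fs.
have {}cA : subdiff f x c^T by move: cA; rewrite inE.
exists c^T => // k fk; set h := c^T in cA *.
rewrite leNgt; apply/negP => d0.
set d := dot _ _ in d0.
set m := dot (k - h) (k - h).
have m0 : 0 <= m by exact: dot_ge0.
(* a step of this length towards [k] stays in the segment and, the linear gain
   [2 * t * d] beating the quadratic loss [t ^+ 2 * m], comes closer to [g] *)
pose t := d / (m + d).
have md : 0 < m + d by rewrite ltr_wpDl.
have t0 : 0 < t by rewrite divr_gt0.
have t1 : t <= 1 by rewrite ler_pdivrMr// mul1r lerDr.
have tmd : t * m <= d.
  by rewrite mulrAC ler_pdivrMr// ler_wpM2l ?lerDl// ltW.
have hk : A (h + t *: (k - h))^T.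
  rewrite /A/= trmxK => y.
  have fh := cA y; have {}fk := fk y.
  have -> : dot (h + t *: (k - h)) (y - x)
      = (1 - t) * dot h (y - x) + t * dot k (y - x) by rewrite !dotE; ring.
  have -> : f x + ((1 - t) * dot h (y - x) + t * dot k (y - x))
      = (1 - t) * (f x + dot h (y - x)) + t * (f x + dot k (y - x)) by ring.
  have -> : f y = (1 - t) * f y + t * f y by ring.
  by rewrite lerD// ler_wpM2l// ?subr_ge0// ltW.
have := cmin _ (mem_set hk); rewrite /F trmxK -/h opprD addrA.
have -> : dot (g - h - t *: (k - h)) (g - h - t *: (k - h))
    = dot (g - h) (g - h) - t * (2 * d - t * m).
  rewrite /d /m; move: (g - h) (k - h) => q r.
  by rewrite !dotE (dotC r q); ring.
rewrite -subr_ge0 addrAC subrr add0r oppr_ge0 pmulr_rle0// => h1.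
by move: h1 tmd d0; lra.
Qed.

End Euclidean.

(** * Patterns and the signs of the roots *)

Section Patterns.
Context {R : realType} {p : nat}.
Implicit Types (b u v w : 'cV[R]_p).

(** The roots of the hyperoctahedral group, as linear forms. The case [i = j] is
    included: it gives twice a coordinate up to sign, or the zero form. *)
Definition broot (c d : bool) (i j : 'I_p) w : R :=
  (-1) ^+ c * w i 0 + (-1) ^+ d * w j 0.

(** In the hyperplane arrangement of the roots, [w] lies in the closure of the
    cone that contains [v]. *)
Definition refines v w : Prop :=
  forall c d i j, 0 <= broot c d i j v -> 0 <= broot c d i j w.

Lemma refines_trans u v w : refines u v -> refines v w -> refines u w.
Proof. by move=> uv vw c d i j /uv /vw. Qed.

Lemma brootD c d i j b (t : R) u :
  broot c d i j (b + t *: u) = broot c d i j b + t * broot c d i j u.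
Proof. by rewrite /broot !mxE; ring. Qed.

Lemma index_sort_undup (s : seq R) x : x \in s ->
  index x (sort <=%R (undup s)) = count (< x)%R (undup s).
Proof.
move=> xs; set t := sort _ _.
have xt : x \in t by rewrite mem_sort mem_undup.
have ts : sorted <%R t by rewrite /t sort_lt_sorted undup_uniq.
have := count_lt_nth x ts _; rewrite -[in X in _ -> X](nth_index x xt) => /(_ (index x t)).
rewrite index_mem xt nth_index// => <-//.
by apply/seq.permP/permEl; exact: perm_sort.
Qed.

(** Ranks depend only on the order of the values. This form serves to compare the
    ranks within the absolute values of two vectors, without matching the two
    lists of distinct values. *)
Lemma count_lt_undup_map (T : Type) (g h : T -> R) (e : seq T) x :
  (forall y z, (g y <= g z) = (h y <= h z)) ->
  count (< g x)%R (undup [seq g y | y <- e])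
    = count (< h x)%R (undup [seq h y | y <- e]).
Proof.
move=> gh; have mem_gh y (r : seq T) :
    (g y \in [seq g z | z <- r]) = (h y \in [seq h z | z <- r]).
  by elim: r => //= z r IH; rewrite !inE IH !eq_le !gh.
elim: e => //= y e IH; rewrite mem_gh.
by case: ifP => //= _; rewrite IH !ltNge gh.
Qed.

Definition abs_values w : seq R := undup (0 :: [seq `|w j 0| | j : 'I_p]).

(** The scalar function that a pattern applies to each coordinate, in the form of
    a count instead of a position in a sorted list. *)
Definition rank_in (L : seq R) (x : R) : R :=
  (count (< `|x|)%R L)%:R * Num.sg x.

Lemma pattE w i : (patt w i 0)%:~R = rank_in (abs_values w) (w i 0) :> R.
Proof.
rewrite mxE rmorphM/= /rank_in sgrEz /abs_rank index_sort_undup//.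
by rewrite inE; apply/orP; right; apply/mapP; exists i; rewrite ?mem_enum.
Qed.

Lemma mem_abs_values w i : `|w i 0| \in abs_values w.
Proof.
by rewrite mem_undup inE; apply/orP; right; apply/mapP; exists i; rewrite ?mem_enum.
Qed.

Lemma rank_inN L x : rank_in L (- x) = - rank_in L x.
Proof. by rewrite /rank_in normrN sgrN mulrN. Qed.

(** The rank map is an odd function, strictly increasing on the values that the
    list records; this is why a pattern keeps the signs of all the roots. *)
Lemma rank_in_le (L : seq R) : 0 \in L -> all (>= 0) L ->
  {in [pred x | `|x| \in L] &, {mono rank_in L : x y / x <= y}}.
Proof.
move=> L0 /allP Lpos.
pose N (x : R) := count (< x)%R L.
have Nlt x y : x \in L -> x < y -> (N x < N y)%N.
  rewrite /N => + xy; elim: L {L0 Lpos N} => //= z r IH; rewrite inE => /predU1P[<-|/IH].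
    by rewrite ltxx xy ltnS; apply: sub_count => t /= /lt_trans; exact.
  move=> h; rewrite -addnS leq_add//.
  by case: (ltP z x) => // /lt_trans->.
have N0 : N 0 = 0%N.
  apply/eqP; rewrite -leqn0 leqNgt -has_count; apply/hasPn => x /Lpos /=.
  by rewrite leNgt.
have E x : 0 <= x -> rank_in L x = (N x)%:R.
  move=> x0; rewrite /rank_in ger0_norm//; have [->|xn0] := eqVneq x 0.
    by rewrite -/(N 0) N0 mul0r.
  by rewrite gtr0_sg ?mulr1// lt0r xn0.
have Npos x : 0 < x -> 0 < rank_in L x.
  by move=> x0; rewrite E ?ltW// ltr0n -{1}N0 Nlt.
have mono0 x y : `|x| \in L -> 0 <= x -> x < y -> rank_in L x < rank_in L y.
  move=> xL x0 xy; rewrite !E ?(le_trans x0 (ltW xy))// ltr_nat Nlt//.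
  by rewrite -(ger0_norm x0).
apply: le_mono_in => x y; rewrite !inE => xL yL xy.
have [x0|x0] := leP 0 x; first exact: mono0.
have [y0|y0] := leP y 0.
  by rewrite -ltrN2 -!rank_inN mono0 ?normrN ?oppr_ge0// ltrN2.
apply: (@lt_trans _ _ 0); last exact: Npos.
by rewrite -oppr_gt0 -rank_inN Npos ?oppr_gt0.
Qed.

(** Applied with the pattern viewed as a real vector, this makes the pattern a
    representative of its own class of vectors. *)
Lemma broot_patt c d i j w :
  (0 <= broot c d i j (map_mx intr (patt w))) = (0 <= broot c d i j w).
Proof.
have P k : map_mx intr (patt w) k 0 = rank_in (abs_values w) (w k 0).
  by rewrite mxE; exact: pattE.
rewrite /broot !P.
have S (e : bool) x : (-1) ^+ e * rank_in (abs_values w) x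
    = rank_in (abs_values w) ((-1) ^+ e * x).
  by case: e; rewrite ?expr1 ?mulN1r ?rank_inN// !expr0 !mul1r.
rewrite !S -[X in _ = (0 <= _ + X)]opprK subr_ge0.
rewrite -[X in (0 <= _ + X)]opprK -rank_inN subr_ge0 rank_in_le ?mem_undup ?mem_head//.
- apply/allP => x; rewrite mem_undup inE => /predU1P[->//|/mapP[k _ ->]].
  exact: normr_ge0.
- by rewrite inE normrN normrM normrX normrN1 expr1n mul1r mem_abs_values.
- by rewrite inE normrM normrX normrN1 expr1n mul1r mem_abs_values.
Qed.

Lemma patt_eqP v w : patt v = patt w <-> refines v w /\ refines w v.
Proof.
split=> [vw|[vw wv]].
  by split=> c d i j; rewrite -(broot_patt _ _ _ _ v) -(broot_patt _ _ _ _ w) vw.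
have E c d i j : (0 <= broot c d i j v) = (0 <= broot c d i j w).
  by apply/idP/idP => [/vw|/wv].
have B (c : bool) i x : (0 <= broot c c i i x) = (0 <= (-1) ^+ c * x i 0).
  by rewrite /broot -mulr2n pmulrn_lge0.
have neg i : (v i 0 < 0) = (w i 0 < 0).
  by rewrite !ltNge; have := E false false i i; rewrite !B !mul1r => ->.
have sg i : Num.sg (v i 0) = Num.sg (w i 0).
  have := E true true i i; rewrite !B expr1 !mulN1r !oppr_ge0.
  rewrite /Num.sg neg !eq_le => ->.
  by have := E false false i i; rewrite !B !mul1r => ->.
have normE i j (x : 'cV[R]_p) : (`|x i 0| <= `|x j 0|)
    = (0 <= broot (x j 0 < 0) (~~ (x i 0 < 0)) j i x).
  rewrite /broot -subr_ge0 !normrEsign; congr (0 <= _ + _).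
  by case: (_ < _); rewrite ?expr1 ?expr0 ?mulN1r ?mul1r ?opprK.
(* the index [None] stands for the value 0 that heads the list of values *)
pose g (x : 'cV[R]_p) (k : option 'I_p) : R := oapp (fun i => `|x i 0|) 0 k.
have gE k l : (g v k <= g v l) = (g w k <= g w l).
  case: k l => [i|] [j|] //=; rewrite ?lexx ?normr_ge0//.
    by rewrite !normE !neg E.
  by rewrite !normr_le0 -(sgr_eq0 (v i 0)) -(sgr_eq0 (w i 0)) sg.
have gL x : abs_values x = undup [seq g x k | k <- None :: [seq Some i | i : 'I_p]].
  by rewrite /abs_values/= -map_comp.
apply/colP => i; apply/(intr_inj (R := R)); rewrite !pattE /rank_in sg.
congr (_%:R * _); rewrite !gL.
exact: (count_lt_undup_map _ (Some i) gE).
Qed.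

Lemma near0_sign (x y : R) : \forall t \near 0^'+,
  (0 <= x + t * y) = (0 < x) || (x == 0) && (0 <= y).
Proof.
have small : \forall t \near (0 : R)^'+, x != 0 -> t * `|y| < `|x|.
  have [->|x0] := eqVneq x 0; first by near=> t.
  near=> t => _; have t0 : 0 < t by near: t; exact: nbhs_right_gt.
  apply: (@le_lt_trans _ _ (t * (`|y| + 1))); first by rewrite ler_wpM2l ?lerDl ?ltW.
  rewrite -ltr_pdivlMr ?ltr_wpDl//; near: t; apply: nbhs_right_lt.
  by rewrite divr_gt0 ?normr_gt0// ltr_wpDl.
near=> t; have t0 : 0 < t by near: t; exact: nbhs_right_gt.
have : x != 0 -> t * `|y| < `|x| by near: t.
have := ler_norm (t * y); have := ler_norm (- (t * y)).
rewrite normrN normrM (gtr0_norm t0) => h1 h2.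
case: (ltgtP x 0) => [xn|xp|->] /=; last by rewrite add0r pmulr_rge0.
  by move=> /(_ isT) h; apply/negbTE; rewrite -ltNge; move: h; rewrite (ltr0_norm xn); lra.
by move=> /(_ isT) h; move: h; rewrite (gtr0_norm xp) => h; lra.
Unshelve. all: by end_near. Qed.

(** The sign of a root at [b + t *: u] is the one at [b] or, if that vanishes, the
    one at [u]; a single bound on [t] serves for all the finitely many roots. *)
Lemma near0_broot b u : \forall t \near 0^'+, forall c d i j,
  (0 <= broot c d i j (b + t *: u))
    = (0 < broot c d i j b) || (broot c d i j b == 0) && (0 <= broot c d i j u).
Proof.
do 4![apply: filter_forall => ?].
by under eq_near do rewrite brootD; exact: near0_sign.
Qed.

End Patterns.

(** * Limiting patterns *)

Section Limits.
Context {R : realType} {p : nat}.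
Implicit Types (b u v w : 'cV[R]_p).

Lemma near0_patt_lim b u : \forall t \near 0^'+, patt (b + t *: u) = patt_lim b u.
Proof.
have [s hs] := filter_ex (near0_broot b u).
apply: (@xgetPex _ 0 [set q | \forall t \near 0^'+, patt (b + t *: u) = q]).
exists (patt (b + s *: u)); near=> t.
have ht : forall c d i j, (0 <= broot c d i j (b + t *: u))
    = (0 < broot c d i j b) || (broot c d i j b == 0) && (0 <= broot c d i j u).
  by near: t; exact: near0_broot.
by apply/patt_eqP; split=> c d i j; rewrite hs ht.
Unshelve. all: by end_near. Qed.

Lemma near0_refines_base b u : \forall t \near 0^'+, refines (b + t *: u) b.
Proof.
apply: filterS (near0_broot b u) => t ht c d i j; rewrite ht [X in _ -> is_true X]le0r.
by case/orP => [->|/andP[-> _]//]; rewrite orbT.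
Qed.

(** Where a root vanishes at [b], its sign at [b + t *: v] is that at [v];
    elsewhere it has at [b + t *: u] and [b + t *: v] the sign it has at [b]. *)
Lemma near0_refines b u v w : refines v u -> patt w = patt_lim b u ->
  \forall t \near 0^'+, refines (b + t *: v) w.
Proof.
move=> vu bu; near=> t.
have /esym : patt (b + t *: u) = patt_lim b u by near: t; exact: near0_patt_lim.
rewrite -bu => /patt_eqP[_ buw].
apply: refines_trans buw => c d i j.
rewrite (near (near0_broot b u) t)// (near (near0_broot b v) t)//.
by case/orP => [->//|/andP[-> /vu ->]]; rewrite orbT.
Unshelve. all: by end_near. Qed.

Lemma patt_lim_congr b u v : patt u = patt v -> patt_lim b u = patt_lim b v.
Proof.
move=> /patt_eqP[uv vu].
have [t [bu [bv [hu hv]]]] := filter_ex (filterI (near0_patt_lim b u)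
  (filterI (near0_patt_lim b v) (filterI (near0_broot b u) (near0_broot b v)))).
rewrite -bu -bv; apply/patt_eqP; split=> c d i j; rewrite hu hv.
  by case/orP => [->//|/andP[-> /uv ->]]; rewrite orbT.
by case/orP => [->//|/andP[-> /vu ->]]; rewrite orbT.
Qed.

Lemma patt_lim_patternE b u : patt_lim_pattern b (patt u) = patt_lim b u.
Proof.
by apply: xget_unique => [v /patt_lim_congr ->|q ->].
Qed.

Lemma refines_eball u :
  exists2 e : R, 0 < e & forall v, eball u e v -> refines v u.
Proof.
(* a coordinate moves by less than [e] in the ball, hence a root by less than
   [e * 2]; no root that is negative at [u] may become nonnegative *)
have near_sign : \forall t \near 0^'+, forall c d i j,
    (0 <= broot c d i j u + t * 2)
      = (0 < broot c d i j u) || (broot c d i j u == 0) && (0 <= 2 :> R).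
  by do 4![apply: filter_forall => ?]; exact: near0_sign.
have [e [e0 he]] := filter_ex (filterI (nbhs_right_gt 0) near_sign).
exists e => // v uv c d i j bv.
suff : 0 <= broot c d i j u + e * 2.
  by rewrite he [X in _ -> is_true X]le0r => /orP[->|/andP[-> _]]//; rewrite orbT.
apply: (le_trans bv); rewrite /broot.
have D (c' : bool) k : (-1) ^+ c' * v k 0 <= (-1) ^+ c' * u k 0 + e.
  rewrite -lerBlDl -mulrBr; apply: (le_trans (ler_norm _)).
  rewrite normrM normrX normrN1 expr1n mul1r.
  have -> : v k 0 - u k 0 = (v - u) k 0 by rewrite !mxE.
  exact: le_trans (coord_le_enorm _ _) (ltW uv).
by rewrite mulr2n mulrDr mulr1 addrACA lerD.
Qed.

End Limits.

(** * Signed permutations and the rearrangement inequality *)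

Section SignedPermutations.
Context {R : realType} {p : nat}.
Implicit Types (lam mu b u v w : 'cV[R]_p) (e : 'I_p -> bool) (s : 'S_p).

Definition signed_perm e s lam : 'cV[R]_p := \col_i ((-1) ^+ e i * lam (s i) 0).

(** The signed permutation [(e, s)] carries [w] to its non-increasing nonnegative
    rearrangement, [(-1) ^+ e i * w i 0] landing at position [s i]. All the
    conditions are signs of roots of [w]. *)
Definition aligned w e s : Prop :=
  (forall i, 0 <= (-1) ^+ e i * w i 0) /\
  (forall i j, (s i <= s j)%N -> (-1) ^+ e j * w j 0 <= (-1) ^+ e i * w i 0).

Lemma dot_signed_perm e s lam w :
  dot (signed_perm e s lam) w = \sum_i lam (s i) 0 * ((-1) ^+ e i * w i 0).
Proof. by apply: eq_bigr => i _; rewrite mxE mulrCA mulrA. Qed.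

Lemma signed_permB e s lam mu :
  signed_perm e s (lam - mu) = signed_perm e s lam - signed_perm e s mu.
Proof. by apply/colP => i; rewrite !mxE mulrBr. Qed.

Lemma enorm_signed_perm e s lam : enorm (signed_perm e s lam) = enorm lam.
Proof.
rewrite /enorm /dot [in RHS](reindex_inj (@perm_inj _ s)).
by congr Num.sqrt; apply: eq_bigr => i _; rewrite !mxE mulrACA -expr2 sqrr_sign mul1r.
Qed.

Lemma aligned_refines v w e s : refines v w -> aligned v e s -> aligned w e s.
Proof.
move=> vw [v0 vs]; split=> [i|i j ij].
  have := vw (e i) (e i) i i; rewrite /broot -!mulr2n !pmulrn_lge0//.
  exact.
have := vw (e i) (~~ e j) i j; rewrite /broot !signrN !mulNr !subr_ge0; apply.
exact: vs.
Qed.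

Lemma aligned_norm w e s i : aligned w e s -> (-1) ^+ e i * w i 0 = `|w i 0|.
Proof.
by move=> [w0 _]; rewrite -(ger0_norm (w0 i)) normrM normrX normrN1 expr1n mul1r.
Qed.

Definition sorted_abs w : seq R := sort >=%R [seq `|w j 0| | j : 'I_p].

Lemma size_sorted_abs w : size (sorted_abs w) = p.
Proof. by rewrite size_sort size_map size_enum_ord. Qed.

(** A non-increasing rearrangement is unique, so that any permutation that
    sorts the absolute values reads off the sorted list. *)
Lemma nth_sorted_abs w s i :
  (forall i j, (s i <= s j)%N -> `|w j 0| <= `|w i 0|) ->
  (sorted_abs w)`_(s i) = `|w i 0|.
Proof.
move=> ws; pose t := [seq `|w ((s^-1)%g k) 0| | k : 'I_p].
have -> : sorted_abs w = t.
  apply: (sorted_eq (leT := >=%R)) => //.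
  - exact: rev_trans le_trans.
  - by move=> x y; rewrite andbC => /le_anti.
  - by apply: sort_sorted => x y; exact: le_total.
  - rewrite /t sorted_pairwise; last exact: rev_trans le_trans.
    rewrite pairwise_map.
    have := iota_ltn_sorted 0 p; rewrite -val_enum_ord sorted_pairwise; last exact: ltn_trans.
    rewrite pairwise_map; apply: sub_pairwise => k l /= kl.
    by apply: ws; rewrite !permKV ltnW.
  - apply: (perm_trans (permEl (perm_sort _ _))).
    have -> : t = [seq `|w j 0| | j <- [seq (s^-1)%g k | k : 'I_p]] by rewrite -map_comp.
    apply: perm_map; apply: uniq_perm.
    + exact: enum_uniq.
    + by rewrite map_inj_uniq ?enum_uniq//; exact: perm_inj.
    + move=> j; rewrite mem_enum; apply/esym/mapP; exists (s j); rewrite ?mem_enum//.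
      by rewrite permK.
by rewrite (nth_map (s i)) ?size_enum_ord// nth_ord_enum permK.
Qed.

Lemma aligned_exists w : exists e s, aligned w e s.
Proof.
pose t := [tuple `|w j 0| | j < p].
have /tuple_permP[s hs] : perm_eq t (sort_tuple >=%R t).
  by rewrite perm_sym; exact: permEl (perm_sort _ _).
exists (fun i => w i 0 < 0), s; split=> [i|i j ij].
  by rewrite -normrEsign.
rewrite -!normrEsign.
have E k : `|w k 0| = tnth (sort_tuple >=%R t) (s k).
  have -> : `|w k 0| = tnth t k by rewrite tnth_mktuple.
  by rewrite (tnth_nth 0) hs -tnth_nth tnth_mktuple.
rewrite !E !(tnth_nth 0).
have ts : sorted >=%R (sort_tuple >=%R t) by apply: sort_sorted => x y; exact: le_total.
apply: (sorted_leq_nth (rev_trans le_trans) _ 0 ts) => //.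
- by rewrite inE size_tuple.
- by rewrite inE size_tuple.
Qed.

Lemma slope_aligned lam w e s :
  aligned w e s -> slope lam w = dot (signed_perm e s lam) w.
Proof.
move=> ws; rewrite dot_signed_perm /slope (reindex_inj (@perm_inj _ s)).
apply: eq_bigr => i _; rewrite (aligned_norm i ws) nth_sorted_abs// => {}i j ij.
by rewrite -!(aligned_norm _ ws); exact: ws.2.
Qed.

(** The rearrangement inequality: at the least index [i] that [s] moves,
    letting [i] keep its own value can only increase the sum, and it leaves
    fewer indices moved. *)
Lemma rearrangement (x y : 'I_p -> R) s :
  (forall i j : 'I_p, (i <= j)%N -> x j <= x i) ->
  (forall i j : 'I_p, (i <= j)%N -> y j <= y i) ->
  \sum_i x i * y (s i) <= \sum_i x i * y i.
Proof.
move=> xs ys; have [n] := ubnP #|[pred i | s i != i]|.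
elim: n s => // n IH s; rewrite ltnS => sn.
case: (pickP [pred i | s i != i]) => [k /= sk|sid]; last first.
  rewrite le_eqVlt; apply/predU1P; left; apply: eq_bigr => i _.
  by have /negbFE/eqP-> := sid i.
case: (arg_minnP (P := fun i => s i != i) (fun i => val i) sk) => i si imin.
pose j := (s^-1)%g i.
have sj : s j = i by rewrite permKV.
have ji : j != i by apply: contra_neq si => e; rewrite -[X in s X]e sj.
have ij : (i <= j)%N by apply: imin; rewrite sj eq_sym.
have isi : (i <= s i)%N by apply: imin; rewrite (inj_eq perm_inj).
pose s' := (tperm i j * s)%g.
have s'i : s' i = i by rewrite permM tpermL.
have s'j : s' j = s i by rewrite permM tpermR.
have s'k l : l != i -> l != j -> s' l = s l by move=> li lj; rewrite permM tpermD// eq_sym.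
apply: (@le_trans _ _ (\sum_l x l * y (s' l))).
  rewrite (bigD1 i)//= (bigD1 j)//= [leRHS](bigD1 i)//= [in leRHS](bigD1 j)//=.
  rewrite !addrA; apply: lerD.
    rewrite s'i s'j sj -subr_ge0.
    have -> : x i * y i + x j * y (s i) - (x i * y (s i) + x j * y i)
        = (x i - x j) * (y i - y (s i)) by ring.
    by rewrite mulr_ge0// subr_ge0 ?xs ?ys.
  by apply: ler_sum => l /andP[li lj]; rewrite s'k.
apply: IH; apply: leq_trans sn; apply: proper_card; apply/properP; split.
  apply/fintype.subsetP => l; rewrite !inE; have [->|li] := eqVneq l i; first by rewrite s'i eqxx.
  have [->|lj] := eqVneq l j; first by rewrite sj (eq_sym i).
  by rewrite s'k.
by exists i; rewrite !inE ?s'i ?eqxx.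
Qed.

(** Taking absolute values disposes of the signs; the rearrangement inequality
    then compares [s] with a permutation that sorts [w]. *)
Lemma slope_ge lam w e s : slope_weights lam ->
  dot (signed_perm e s lam) w <= slope lam w.
Proof.
move=> [lams lam0]; have [e1 [s1 ws]] := aligned_exists w.
have sorted1 i j : (s1 i <= s1 j)%N -> `|w j 0| <= `|w i 0|.
  by move=> ij; rewrite -!(aligned_norm _ ws); exact: ws.2.
apply: (@le_trans _ _ (\sum_i lam (s i) 0 * `|w i 0|)).
  rewrite dot_signed_perm; apply: ler_sum => i _; rewrite ler_wpM2l//.
  by apply: le_trans (ler_norm _) _; rewrite normrM normrX normrN1 expr1n mul1r.
rewrite (reindex_inj (@perm_inj _ (s^-1)%g)) /slope -/(sorted_abs w).
under eq_bigr do rewrite permKV -(nth_sorted_abs _ sorted1).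
have := @rearrangement (fun i => lam i 0) (fun i => (sorted_abs w)`_i) (s^-1 * s1)%g.
rewrite (eq_bigr (fun i => lam i 0 * (sorted_abs w)`_(s1 ((s^-1)%g i)))) => [|i _]; last first.
  by rewrite permM.
apply=> // i j ij.
have ts : sorted >=%R (sorted_abs w) by apply: sort_sorted => x y; exact: le_total.
apply: (sorted_leq_nth (rev_trans le_trans) _ 0 ts) => //.
- by rewrite inE size_sorted_abs.
- by rewrite inE size_sorted_abs.
Qed.

End SignedPermutations.

(** * Directional derivatives and subdifferentials *)

Section Subdifferentials.
Context {R : realType} {p : nat}.
Implicit Types (lam mu b u v w g : 'cV[R]_p).

(** The convex hull of the vectors [signed_perm e s lam] with [(e, s)] aligned
    with [w], described as the intersection of its supporting half-spaces: in
    each direction some vertex goes at least as far as [g]. In this form the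
    subdifferentials are computed without any separation argument. *)
Definition active_hull lam w : set 'cV[R]_p :=
  [set g | forall y, exists e s,
    aligned w e s /\ dot g y <= dot (signed_perm e s lam) y].

Lemma active_hull_congr lam v w :
  patt v = patt w -> active_hull lam v = active_hull lam w.
Proof.
move=> /patt_eqP[vw wv]; apply/seteqP; split=> g hg y;
  have [e [s [a h]]] := hg y; exists e, s; split=> //;
  by apply: aligned_refines a.
Qed.

Lemma near0_aligned b v : exists e s,
  \forall t \near 0^'+, aligned (b + t *: v) e s.
Proof.
have [t0 bt0] := filter_ex (near0_patt_lim b v).
have [e [s a]] := aligned_exists (b + t0 *: v).
exists e, s; apply: filterS (near0_patt_lim b v) => t bt.
apply: aligned_refines a.
by have /patt_eqP[] : patt (b + t0 *: v) = patt (b + t *: v) by rewrite bt.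
Qed.

Lemma slope_dirE lam b v e s : (\forall t \near 0^'+, aligned (b + t *: v) e s) ->
  slope_dir lam b v = dot (signed_perm e s lam) v.
Proof.
move=> a; apply: lim_near_cst => //; near=> t.
have t0 : 0 < t by near: t; exact: nbhs_right_gt.
have at_ : aligned (b + t *: v) e s by near: t.
have a0 : aligned b e s.
  by apply: aligned_refines at_; near: t; exact: near0_refines_base.
rewrite (slope_aligned lam at_) (slope_aligned lam a0) dotDr dotZr.
by rewrite addrAC subrr add0r mulrAC mulfV ?mul1r// gt_eqF.
Unshelve. all: by end_near. Qed.

(** The vectors active at [b] are subgradients there, and a directional
    derivative dominates every subgradient. *)
Lemma slope_dir_ge lam b v e s : slope_weights lam -> aligned b e s ->
  dot (signed_perm e s lam) v <= slope_dir lam b v.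
Proof.
move=> lamW a; have [e1 [s1 a1]] := near0_aligned b v.
have [t [t0 [a1t bt]]] := filter_ex (filterI (nbhs_right_gt 0)
  (filterI a1 (near0_refines_base b v))).
rewrite (slope_dirE lam a1) -(ler_pM2l t0) -!dotZr.
have := slope_ge (b + t *: v) e s lamW.
rewrite (slope_aligned lam a1t) !dotDr -(slope_aligned lam a).
by rewrite -(slope_aligned lam (aligned_refines bt a1t)) lerD2l.
Qed.

(** Moving from [w] towards [y], the active vectors at the points reached are
    active at [w] too, so a subgradient cannot exceed all of them in direction
    [y]. Conversely, the active vectors agree on [- w], which turns the
    inequality in direction [- w] into equality of [dot g w] and the norm. *)
Lemma subdiff_slopeE lam w : slope_weights lam ->
  subdiff (slope lam) w = active_hull lam w.
Proof.
move=> lamW; apply/seteqP; split=> g hg y.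
  have [e [s a]] := near0_aligned w y.
  have [t [t0 [at_ wt]]] := filter_ex (filterI (nbhs_right_gt 0)
    (filterI a (near0_refines_base w y))).
  have a0 := aligned_refines wt at_.
  exists e, s; split=> //; have := hg (w + t *: y).
  rewrite addrAC subrr add0r (slope_aligned lam at_) (slope_aligned lam a0).
  by rewrite dotDr lerD2l !dotZr ler_pM2l.
have [e [s [a hw]]] := hg (- w); have [e1 [s1 [_ hy]]] := hg y.
move: hw; rewrite !dotNr -(slope_aligned lam a) lerN2 => hw.
have := slope_ge y e1 s1 lamW; rewrite dotDr dotNr.
by move: hw hy; lra.
Qed.

(** The argument of [subdiff_slopeE], one order further: a direction near [u] has
    its active vectors among those of [w], all of which take at [u] the value of
    the directional derivative, and all of which are active at [b]. *)
Lemma subdiff_slope_dirE lam b u w : slope_weights lam ->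
  patt w = patt_lim b u -> subdiff (slope_dir lam b) u = active_hull lam w.
Proof.
move=> lamW wbu.
have dir_at e s : aligned w e s -> slope_dir lam b u = dot (signed_perm e s lam) u.
  move=> a; apply: slope_dirE; apply: filterS (near0_patt_lim b u) => t.
  by rewrite -wbu => /esym/patt_eqP[wt _]; apply: aligned_refines a.
have base e s : aligned w e s -> aligned b e s.
  have [t [bt rt]] := filter_ex (filterI (near0_patt_lim b u) (near0_refines_base b u)).
  move: bt; rewrite -wbu => /patt_eqP[_ wt] a.
  by apply: aligned_refines rt _; apply: aligned_refines a.
apply/seteqP; split=> g hg y.
  have [t [t0 ut]] := filter_ex (filterI (nbhs_right_gt 0) (near0_refines_base u y)).
  have [e [s a]] := near0_aligned b (u + t *: y).
  have [r [ar rw]] := filter_ex (filterI a (near0_refines ut wbu)).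
  have aw := aligned_refines rw ar.
  exists e, s; split=> //; have := hg (u + t *: y).
  rewrite addrAC subrr add0r (slope_dirE lam a) (dir_at _ _ aw).
  by rewrite dotDr lerD2l !dotZr ler_pM2l.
have [e [s [a hu]]] := hg (- u); have [e1 [s1 [a1 hy]]] := hg y.
move: hu; rewrite !dotNr -(dir_at _ _ a) lerN2 => hu.
have := slope_dir_ge y lamW (base _ _ a1); rewrite dotDr dotNr.
by move: hu hy; lra.
Qed.

Lemma slope_weightsZ (a : R) lam : 0 <= a ->
  slope_weights lam -> slope_weights (a *: lam).
Proof.
by move=> a0 [lams lam0]; split=> [i j ij|i]; rewrite !mxE; [rewrite ler_wpM2l ?lams|rewrite mulr_ge0].
Qed.

Lemma slopeZ (a : R) lam w : slope (a *: lam) w = a * slope lam w.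
Proof. by rewrite /slope mulr_sumr; apply: eq_bigr => i _; rewrite mxE mulrA. Qed.

(** The factor [a] of the inner map can be moved to the weights because the norm
    is linear in them. *)
Lemma subdiff_slope_affine (a : R) lam b u : 0 < a ->
  subdiff (fun v => slope lam (b + a *: v)) u
    = subdiff (slope (a *: lam)) (b + a *: u).
Proof.
move=> a0; have an0 : a != 0 by rewrite gt_eqF.
apply/seteqP; split=> g hg y /=.
  have := hg (a^-1 *: (y - b)); rewrite scalerA mulfV// scale1r.
  have -> : b + (y - b) = y by rewrite addrC subrK.
  rewrite !slopeZ -(ler_pM2l a0) mulrDr -dotZr scalerBr scalerA mulfV// scale1r.
  by rewrite opprD addrA.
have := hg (b + a *: y); rewrite !slopeZ opprD addrACA subrr add0r -scalerBr.
by rewrite dotZr -mulrDr ler_pM2l.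
Qed.

(** With [h] the projection of [g] onto the target, some vertex
    [signed_perm e s mu] goes at least as far as [g] in the direction [g - h],
    the vertex [signed_perm e s lam] of the target goes no further than [h], and
    the two vertices are at distance [enorm (mu - lam)]. *)
Lemma slope_thickening mu lam w : slope_weights mu -> slope_weights lam ->
  subdiff (slope mu) w `<=` thickening (subdiff (slope lam) w) (enorm (mu - lam)).
Proof.
move=> muW lamW g; rewrite subdiff_slopeE// => hg.
have ne : subdiff (slope lam) w !=set0.
  have [e [s a]] := aligned_exists w; exists (signed_perm e s lam).
  by rewrite subdiff_slopeE// => y; exists e, s.
have [h hh hproj] := subdiff_projection g ne.
apply: (@le_trans _ _ (enorm (g - h))%:E).
  by apply: ereal_inf_lbound; exists h.
rewrite lee_fin; have [e [s [a gd]]] := hg (g - h).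
have hk : subdiff (slope lam) w (signed_perm e s lam).
  by rewrite subdiff_slopeE// => y; exists e, s.
have := hproj _ hk; rewrite (dotC (g - h)) !dotDl !dotNl subr_le0 => hle.
have cs := dot_le_enorm (signed_perm e s (mu - lam)) (g - h).
rewrite enorm_signed_perm signed_permB dotDl dotNl in cs.
have : enorm (g - h) ^+ 2 <= enorm (mu - lam) * enorm (g - h).
  by rewrite sqr_enorm dotDl dotNl; lra.
have [->|d0] := eqVneq (enorm (g - h)) 0; first by rewrite enorm_ge0.
by rewrite expr2 ler_pM2r// lt0r d0 enorm_ge0.
Qed.

Lemma hausdorff_dist_ge0 (A B : set 'cV[R]_p) : (0 <= hausdorff_dist A B)%E.
Proof. by apply: le_ereal_inf_tmp => _ [d [d0 _ _] <-]; rewrite lee_fin. Qed.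

Lemma hausdorff_dist_slope mu lam w : slope_weights mu -> slope_weights lam ->
  (hausdorff_dist (subdiff (slope mu) w) (subdiff (slope lam) w)
    <= (enorm (mu - lam))%:E)%E.
Proof.
move=> muW lamW; apply: ereal_inf_lbound; exists (enorm (mu - lam)) => //; split.
- exact: enorm_ge0.
- exact: slope_thickening.
- by rewrite -enormN opprB; exact: slope_thickening.
Qed.

End Subdifferentials.

(** * The local representation *)

Section LocalRepresentation.
Context {R : realType} {p : nat}.
Implicit Types (lam v w : 'cV[R]_p).

Lemma sign_mxE (q : 'cV[int]_p) :
  sign_mx q = diag_mx (\row_i (-1) ^+ (q i 0 < 0)%R) :> 'M[R]_p.
Proof.
congr diag_mx; apply/rowP => i; rewrite !mxE.
by case: (ltgtP (q i 0) 0) => h; rewrite ?(ltr0_sgz h) ?(gtr0_sgz h).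
Qed.

Lemma sorting_perm_mxP (q : 'cV[int]_p) (P : 'M[R]_p) : sorting_perm_mx q P ->
  exists2 r : 'S_p, P = perm_mx r & forall i j, (r i <= r j)%N ->
    `|map_mx intr q j 0 : R| <= `|map_mx intr q i 0|.
Proof.
move=> [/is_perm_mxP[r ->] sorted_q]; exists r => // i j ij.
have absE : (perm_mx r)^T *m abs_pattern q = \col_k `|map_mx intr q ((r^-1)%g k) 0 : R|.
  by apply/colP => l; rewrite tr_perm_mx -row_permE !mxE intr_norm.
by have := sorted_q _ _ ij; rewrite absE// mxE [in X in _ <= X]mxE !permK.
Qed.

(** With [q] the pattern of [w], the matrix [sign_mx q *m P] is a signed
    permutation aligned with [w], and the others come from it by left
    multiplication by the stabilizer of [q], which is the conjugate by
    [sign_mx q] of the stabilizer of its absolute value. *)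
Lemma pattern_stab_aligned (P : 'M[R]_p) lam w :
  sorting_perm_mx (patt w) P ->
  [set sign_mx (patt w) *m A *m P *m lam | A in pattern_stab (patt w)]
    = [set a | exists e s, aligned w e s /\ a = signed_perm e s lam].
Proof.
set q := patt w => /sorting_perm_mxP[r ->]; set x : 'cV[R]_p := map_mx intr q => xr.
have wx e s : aligned w e s <-> aligned x e s.
  by split; apply: aligned_refines => c d i j; rewrite broot_patt.
have sgx i : (-1) ^+ (q i 0 < 0)%R * x i 0 = `|x i 0|.
  have -> : x i 0 = (q i 0)%:~R by rewrite [LHS]mxE.
  by rewrite normrEsign ltrz0.
have vecE d (s : 'S_p) :
    sign_mx q *m (diag_mx d *m perm_mx s) *m perm_mx r *m lam
      = \col_i ((-1) ^+ (q i 0 < 0)%R * (d 0 i * lam (r (s i)) 0)).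
  rewrite -!mulmxA -!row_permE sign_mxE !mul_diag_mx.
  by apply/colP => i; rewrite !mxE.
have stabE d (s : 'S_p) i :
    (diag_mx d *m perm_mx s *m abs_pattern q) i 0 = d 0 i * `|x (s i) 0|.
  by rewrite -mulmxA -row_permE mul_diag_mx !mxE intr_norm.
have absE i : abs_pattern q i 0 = `|x i 0| by rewrite !mxE intr_norm.
(* the two inclusions: the factorization of an aligned [(e, s)] as
   sign of [q], stabilizer element, sorting permutation [r], and its inverse *)
apply/seteqP; split=> [_ [_ [[d [s [d1 ->]]] /colP fixq] <-]|_ [e [s [/wx a ->]]]].
  have {}fixq i : d 0 i * `|x (s i) 0| = `|x i 0| by rewrite -stabE fixq absE.
  have dx i : d 0 i * `|x i 0| = `|x i 0| /\ `|x (s i) 0| = `|x i 0|.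
    (* a sign -1 is possible only where both entries vanish *)
    have := fixq i; case: (d1 i) => ->; first by rewrite !mul1r.
    have := normr_ge0 (x i 0); have := normr_ge0 (x (s i) 0).
    by move=> *; split; lra.
  exists (fun i => (q i 0 < 0)%R (+) (d 0 i == -1)), (s * r)%g.
  have dE i : d 0 i = (-1) ^+ (d 0 i == -1).
    case: (d1 i) => ->; rewrite ?eqxx// -subr_eq0 opprK.
    by rewrite -mulr2n pnatr_eq0.
  have eE i : (-1) ^+ ((q i 0 < 0)%R (+) (d 0 i == -1)) * x i 0 = `|x i 0|.
    by rewrite signr_addb mulrAC sgx -dE mulrC; have [] := dx i.
  split; last by rewrite vecE; apply/colP => i; rewrite !mxE signr_addb -dE permM mulrA.
  apply/wx; split=> [i|i j]; rewrite !eE// !permM => /xr.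
  by have [_ ->] := dx i; have [_ ->] := dx j.
have as_ := a.2.
have se i : (-1) ^+ e i * x i 0 = `|x i 0| := aligned_norm i a.
have xs i j : (s i <= s j)%N -> `|x j 0| <= `|x i 0|.
  by move=> /as_; rewrite !se.
pose d : 'rV[R]_p := \row_i ((-1) ^+ (q i 0 < 0)%R * (-1) ^+ e i).
exists (diag_mx d *m perm_mx (s * r^-1)%g); last first.
  rewrite vecE; apply/colP => i; rewrite !mxE permM permKV !mulrA.
  by rewrite -signr_addb addbb mul1r.
split.
  exists d, (s * r^-1)%g; split=> // i; rewrite mxE -signr_addb.
  by case: (_ (+) _); [right|left].
apply/colP => i; rewrite stabE absE.
have -> : `|x ((s * r^-1)%g i) 0| = `|x i 0|.
  by rewrite -(nth_sorted_abs i xs) -(nth_sorted_abs _ xr) permM permKV.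
by rewrite mxE -[in LHS]sgx mulrACA -signr_addb addbb mul1r se.
Qed.

Lemma slope_localE (P : 'M[R]_p) lam v w e s :
  sorting_perm_mx (patt w) P -> aligned w e s ->
  (forall e1 s1, aligned w e1 s1 ->
     dot (signed_perm e1 s1 lam) v <= dot (signed_perm e s lam) v) ->
  slope_local P lam (patt w) v = dot (signed_perm e s lam) v.
Proof.
move=> Psort a max_a; rewrite /slope_local.
have -> : [set dot (sign_mx (patt w) *m A *m P *m lam) v | A in pattern_stab (patt w)]
    = [set dot z v | z in [set a | exists e s, aligned w e s /\ a = signed_perm e s lam]].
  rewrite -(pattern_stab_aligned lam Psort); apply/seteqP; split=> _ [z hz <-].
    by exists (sign_mx (patt w) *m z *m P *m lam) => //; exists z.
  by case: hz => A hA <-; exists A.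
set E := [set _ | _ in _].
have Ea : E (dot (signed_perm e s lam) v) by exists (signed_perm e s lam) => //; exists e, s.
have Eub : ubound E (dot (signed_perm e s lam) v).
  by move=> _ [_ [e1 [s1 [a1 ->]]] <-]; exact: max_a.
apply/eqP; rewrite eq_le; apply/andP; split.
  by apply: ge_sup => //; exists (dot (signed_perm e s lam) v).
by apply: ub_le_sup => //; exists (dot (signed_perm e s lam) v).
Qed.

(** An [(e, s)] aligned with [b + t *: v] for small [t] computes the left-hand
    side; it is aligned with [w], and among those it attains the maximum, since
    every other one is aligned with [b] and is dominated by the derivative. *)
Lemma slope_dir_local (P : 'M[R]_p) lam b u v w : slope_weights lam ->
  sorting_perm_mx (patt w) P -> patt w = patt_lim b u -> refines v u ->
  slope_dir lam b v = slope_local P lam (patt w) v.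
Proof.
move=> lamW Psort wbu vu; have [e [s a]] := near0_aligned b v.
have [t [at_ wt]] := filter_ex (filterI a (near0_refines vu wbu)).
rewrite (slope_dirE lam a) (slope_localE Psort (aligned_refines wt at_))// => e1 s1 a1.
rewrite -(slope_dirE lam a); apply: slope_dir_ge => //.
have [r [br rb]] := filter_ex (filterI (near0_patt_lim b u) (near0_refines_base b u)).
apply: aligned_refines rb _; apply: aligned_refines a1.
by move: br; rewrite -wbu => /patt_eqP[].
Qed.

End LocalRepresentation.

Lemma invsqrt_cvg (R : realType) :
  (Num.sqrt (n%:R : R))^-1 @[n --> \oo] --> (0 : R)^'+.
Proof.
have sqrt_pos : \forall n \near \oo, 0 < Num.sqrt (n%:R : R).
  by near=> n; rewrite sqrtr_gt0 ltr0n; near: n; exact: nbhs_infty_gt.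
have sqrt_cvg : Num.sqrt (n%:R : R) @[n --> \oo] --> +oo.
  apply/cvgryPgt => A; near=> n; apply: (le_lt_trans (ler_norm A)).
  rewrite -sqrtr_sqr ltr_sqrt; last by rewrite ltr0n; near: n; exact: nbhs_infty_gt.
  by near: n; exact: nbhs_infty_gtr.
move=> A /((gtr0_cvgV0 sqrt_pos).2 sqrt_cvg) hA.
have {}hA : \forall n \near \oo,
    0 < (Num.sqrt (n%:R : R))^-1 -> A (Num.sqrt (n%:R : R))^-1 by exact: hA.
apply: filterS2 hA sqrt_pos => n hA n0; apply: hA.
by rewrite invr_gt0.
Unshelve. all: by end_near. Qed.

Theorem proposition3p7 (R : realType) (p : nat)
    (Pi : 'cV[int]_p -> 'M[R]_p)
    (Pi_sorting : forall q, patterns R p q -> sorting_perm_mx q (Pi q))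
    (beta0 : 'cV[R]_p) (lamn : nat -> 'cV[R]_p) (lam : 'cV[R]_p)
    (lamn_weights : forall n, (0 < n)%N -> slope_weights (lamn n))
    (lam_weights : slope_weights lam)
    (lamn_cvg : (Num.sqrt (n%:R : R))^-1 *: lamn n @[n --> \oo] --> lam)
    (u : 'cV[R]_p) :
  let pp := patt u in
  let pp0 := patt_lim_pattern beta0 pp in
  [/\ exists eps : R, 0 < eps /\
        forall v, eball u eps v ->
          slope_dir lam beta0 v = slope_local (Pi pp0) lam pp0 v,
      subdiff_slope_dir_pattern lam beta0 pp = subdiff_slope_pattern lam pp0
    & hausdorff_dist
        (subdiff (fun v => slope (lamn n)
                    (beta0 + (Num.sqrt (n%:R : R))^-1 *: v)) u)
        (subdiff_slope_dir_pattern lam beta0 pp)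
        @[n --> \oo] --> 0%E ].
Proof.
move=> pp pp0.
have [t0 wbu] := filter_ex (near0_patt_lim beta0 u).
set w := beta0 + t0 *: u in wbu.
have wpp0 : patt w = pp0 by rewrite /pp0 patt_lim_patternE.
have dirE : subdiff_slope_dir_pattern lam beta0 pp = active_hull lam w.
  apply: xget_unique => [v vu|D hD].
    by apply: subdiff_slope_dirE => //; rewrite wbu; exact: patt_lim_congr.
  by rewrite -(hD u)//; exact: subdiff_slope_dirE.
have slopeE : subdiff_slope_pattern lam pp0 = active_hull lam w.
  apply: xget_unique => [v vw|D hD].
    by rewrite subdiff_slopeE//; apply: active_hull_congr; rewrite wpp0.
  by rewrite -(hD w)//; exact: subdiff_slopeE.
split; last 1 first.
- rewrite dirE -subdiff_slopeE//.
  pose a n : R := (Num.sqrt (n%:R : R))^-1.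
  have a0 n : (0 < n)%N -> 0 < a n by move=> n0; rewrite invr_gt0 sqrtr_gt0 ltr0n.
  have a_cvg : a n @[n --> \oo] --> 0^'+ by exact: invsqrt_cvg.
  have enorm_cvg : (enorm (a n *: lamn n - lam))%:E @[n --> \oo] --> 0%E.
    apply: cvg_EFin; first exact: nearW.
    rewrite -[X in _ --> X](_ : enorm (0 : 'cV[R]_p) = 0); last first.
      by rewrite /enorm -(scale0r 0) dotZl mul0r sqrtr0.
    have coord_cvg i : (a n *: lamn n - lam) i 0 @[n --> \oo] --> (0 : 'cV[R]_p) i 0.
      have -> : (fun n => (a n *: lamn n - lam) i 0)
          = (fun n => (a n *: lamn n) i 0 - lam i 0).
        by apply/funext => n; rewrite [LHS]mxE [X in _ + X]mxE.
      rewrite mxE -(subrr (lam i 0)); apply: cvgB; last exact: cvg_cst.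
      apply: (cvg_comp _ (fun z : 'cV[R]_p => z i 0) lamn_cvg).
      exact: (@coord_continuous R p 1 i 0 lam).
    apply: (cvg_comp _ Num.sqrt (cvg_dot coord_cvg coord_cvg)).
    exact: sqrt_continuous.
  have patt_near : \forall n \near \oo, patt (beta0 + a n *: u) = patt_lim beta0 u.
    exact: (a_cvg _ (near0_patt_lim beta0 u)).
  apply: (squeeze_cvge _ (cvg_cst 0%E) enorm_cvg).
  near=> n; rewrite hausdorff_dist_ge0/=.
  have n0 : (0 < n)%N by near: n; exact: nbhs_infty_gt.
  rewrite subdiff_slope_affine ?a0//.
  have anW : slope_weights (a n *: lamn n).
    by apply: slope_weightsZ; rewrite ?ltW ?a0//; exact: lamn_weights.
  have -> : subdiff (slope (a n *: lamn n)) (beta0 + a n *: u)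
      = subdiff (slope (a n *: lamn n)) w.
    rewrite !subdiff_slopeE//; apply: active_hull_congr; rewrite wbu.
    by near: n.
  exact: hausdorff_dist_slope.
- have [eps eps0 ball_u] := refines_eball u; exists eps; split=> // v /ball_u vu.
  rewrite -wpp0; apply: slope_dir_local wbu vu => //.
  by apply: Pi_sorting; exists w.
- by rewrite dirE slopeE.
Unshelve. all: by end_near. Qed.
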